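(* Let $M$ be a spectral geometry on a compact metric space $X$ with support $B$, and assume that its relative bounding radius satisfies $\nu(B)<\infty$. Then $\dim M\ge\dim_H X$, where $\dim_H X$ is the Hausdorff dimension of $X$.
   Context: $|xy|$ is the distance in $X$; $\Delta\subset X^2$ is the diagonal; $|b|=|yy'|$ for $b=(y,y')$. Spectral geometry (in the concrete form to which every axiomatically defined one is isomorphic): a triple $M=M(B,m)=\{\mathcal A,\mathcal H,ds\}$ where $B\subset X^2\setminus\Delta$ (the support) is symmetric under $(y,y')\mapsto(y',y)$ and $B_t=\{b\in B:|b|\ge t\}$ is finite for each $t>0$; $m:B\to\mathbb N$ is a symmetric function; $\mathcal H$ consists of square-summable sections $\xi$ on $B$, $\xi(y,y')\in\mathbb C^{m(y,y')}$; $\mathcal A$ is the algebra of Lipschitz functions on $X$ acting by $(\pi(a)\xi)(y,y')=a(y)\xi(y,y')$; $(ds\,\xi)(y,y')=|yy'|\xi(y',y)$. Relative bounding radius: $Y_t\subset X$ is the projection of $B_t$ to $X$, $\delta(t)=\inf\{\delta>0: X\subset\bigcup_{y\in Y_t}D_\delta(y)\}$ with $D_\delta(y)$ the closed ball of radius $\delta$, and $\nu(B)=\limsup_{t\to0}\delta(t)/t$. Dixmier trace: $\omega$ is a fixed generalized limit (dilation-invariant state on bounded sequences extending the ordinary limit). For positive bounded diagonalizable $T$ with eigenvalues $\mu_0\ge\mu_1\ge\dots$ (with multiplicity, padded by zeros), $\sigma_N(T)=\sum_{n<N}\mu_n$; $\mathrm{Tr}_\omega(T)=\lim_\omega\sigma_N(T)/\log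 N$ if $\sigma_N(T)/\log N$ is bounded, $\infty$ otherwise. Dimension of $M$: $\dim M=\sup\{p\ge0:\mathrm{Tr}_\omega(|ds|^p)=\infty\}=\inf\{p\ge0:\mathrm{Tr}_\omega(|ds|^p)=0\}$ (with $\sup\emptyset=0$, $\inf\emptyset=\infty$; the two coincide). *)

(* Defs.v *)
From HB Require Import structures.
From mathcomp Require Import all_boot all_order all_algebra.
From mathcomp Require Import all_classical all_reals all_analysis.
From mathcomp Require Import complex.

Set Implicit Arguments.
Unset Strict Implicit.
Unset Printing Implicit Defensive.

Import Order.TTheory GRing.Theory Num.Theory.
Import numFieldTopology.Exports numFieldNormedType.Exports.

Local Open Scope classical_set_scope.
Local Open Scope ring_scope.
Local Open Scope complex_scope.

Section hausdorff_dimension.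
Context {R : realType} (X : metricType R).

Definition diam (U : set X) : \bar R :=
  ereal_sup [set (mdist u.1 u.2)%:E | u in U `*` U].

(* The empty set is given weight 0 even for s = 0, so that a countable cover
   may be padded with empty sets. *)
Definition hausdorff_weight (s : R) (U : set X) : \bar R :=
  if U == set0 then 0%E else poweR (diam U) s.

Definition hausdorff_premeasure (s delta : R) (A : set X) : \bar R :=
  ereal_inf [set (\sum_(0 <= k <oo) hausdorff_weight s (F k))%E |
    F in [set F : nat -> set X |
           A `<=` \bigcup_k F k /\ forall k, (diam (F k) <= delta%:E)%E]].

Definition hausdorff_measure (s : R) (A : set X) : \bar R :=
  ereal_sup [set hausdorff_premeasure s delta A | delta in [set d : R | 0 < d]].

Definition hausdorff_dim (A : set X) : \bar R :=
  ereal_inf [set s%:E |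
    s in [set s : R | 0 <= s /\ hausdorff_measure s A = 0%E]].

End hausdorff_dimension.

Section l2.
Context {R : realType} (I : choiceType).
Implicit Types (xi eta : I -> R[i]) (T S : (I -> R[i]) -> (I -> R[i])).

Definition l2norm2 xi : \bar R :=
  (\esum_(i in [set: I]) (complex.Re (xi i) ^+ 2 + complex.Im (xi i) ^+ 2)%:E)%E.

Definition l2 : set (I -> R[i]) := [set xi | (l2norm2 xi < +oo)%E].

(* Unordered sums; meaningful for absolutely summable families. *)
Definition rsum (g : I -> R) : R :=
  fine (\esum_(i in [set: I]) (Num.max (g i) 0)%:E)%E
  - fine (\esum_(i in [set: I]) (Num.max (- g i) 0)%:E)%E.

Definition csum (f : I -> R[i]) : R[i] :=
  rsum (fun i => complex.Re (f i)) +i* rsum (fun i => complex.Im (f i)).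

Definition l2dot xi eta : R[i] := csum (fun i => conjc (xi i) * eta i).

(* Operators are total functions on all families, but only their restriction
   to l2 is ever meaningful or specified. *)
Definition bounded_op T : Prop :=
  (forall (a : R[i]) xi eta, l2 xi -> l2 eta ->
     T (fun i => a * xi i + eta i) = (fun i => a * T xi i + T eta i)) /\
  (exists K : R, forall xi, l2 xi -> (l2norm2 (T xi) <= K%:E * l2norm2 xi)%E).

Definition is_adjoint T S : Prop :=
  forall xi eta, l2 xi -> l2 eta -> l2dot (T xi) eta = l2dot xi (S eta).

(* The order on R[i] makes 0 <= z imply that z is real. *)
Definition positive_op T : Prop := forall xi, l2 xi -> 0 <= l2dot xi (T xi).

(* |T| is the positive square root of T^* T. *)
Definition abs_op T : (I -> R[i]) -> (I -> R[i]) :=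
  xget (fun=> cst 0) [set S | [/\ bounded_op S, positive_op S &
    exists2 T', bounded_op T' /\ is_adjoint T T' &
      forall xi, l2 xi -> S (S xi) = T' (T xi)]].

Definition eigenvector T (lambda : R) xi : Prop :=
  l2 xi /\ T xi = (fun i => lambda%:C * xi i).

(* T^p for T positive and diagonalizable and p >= 0: the eigenvectors of T
   are total, so their images determine a bounded operator. *)
Definition pow_op T (p : R) : (I -> R[i]) -> (I -> R[i]) :=
  xget (fun=> cst 0) [set S | bounded_op S /\
    forall (lambda : R) xi, eigenvector T lambda xi ->
      S xi = (fun i => (lambda `^ p)%:C * xi i)].

(* mu lists the eigenvalues of T in nonincreasing order, with multiplicity and
   padded by zeros: the terms mu n > 0 belong to an orthonormal system e of
   eigenvectors, on whose orthogonal complement T vanishes. *)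
Definition is_eigenvalue_seq T (mu : nat -> R) : Prop :=
  [/\ forall n, 0 <= mu n,
      forall m n, (m <= n)%N -> mu n <= mu m &
      exists e : nat -> (I -> R[i]),
        [/\ forall n, 0 < mu n -> eigenvector T (mu n) (e n),
            forall m n, 0 < mu m -> 0 < mu n ->
              l2dot (e m) (e n) = (m == n)%:R &
            forall xi, l2 xi ->
              (forall n, 0 < mu n -> l2dot (e n) xi = 0) -> T xi = cst 0]].

Definition eigenvalues T : nat -> R :=
  xget (cst 0) [set mu | is_eigenvalue_seq T mu].

End l2.

Section dixmier_trace.
Context {R : realType}.
Implicit Types (u v : nat -> R) (w : (nat -> R) -> R).

Record generalized_limit w : Prop := GeneralizedLimit {
  glim_linear : forall (a : R) u v, bounded_fun u -> bounded_fun v ->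
    w (fun n => a * u n + v n) = a * w u + w v;
  glim_ge0 : forall u, bounded_fun u -> (forall n, 0 <= u n) -> 0 <= w u;
  glim_lim : forall u (l : R), u @ \oo --> l -> w u = l;
  (* u_0, ..., u_0, u_1, ..., u_1, ... with each term repeated k times *)
  glim_dilation : forall (k : nat) u, (0 < k)%N -> bounded_fun u ->
    w (fun n => u (n %/ k)%N) = w u
}.

(* The values at N = 0, 1, where the quotient is 0 by convention, affect
   neither boundedness nor the generalized limit. *)
Definition log_means (mu : nat -> R) : nat -> R :=
  fun N => (\sum_(n < N) mu n) / ln N%:R.

Definition dixmier_trace w (I : choiceType)
    (T : (I -> R[i]) -> (I -> R[i])) : \bar R :=
  let u := log_means (eigenvalues T) in
  if `[< bounded_fun u >] then (w u)%:E else +oo%E.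

End dixmier_trace.

Section pairs.
Context {R : realType} {X : metricType R}.

Definition pair_length (b : X * X) : R := mdist b.1 b.2.

Definition pair_swap (b : X * X) : X * X := (b.2, b.1).

Definition long_pairs (B : set (X * X)) (t : R) : set (X * X) :=
  B `&` [set b | t <= pair_length b].

End pairs.

(* The multiplicity is extended by 0 outside of the support. *)
Record spectral_geometry (R : realType) (X : metricType R) := SpectralGeometry {
  sg_supp : set (X * X);
  sg_mult : X * X -> nat;
  sg_supp_offdiag : sg_supp `<=` [set b | b.1 <> b.2];
  sg_supp_swap : forall b, sg_supp b -> sg_supp (pair_swap b);
  sg_supp_finite : forall t : R, 0 < t -> finite_set (long_pairs sg_supp t);
  sg_multP : forall b, (0 < sg_mult b)%N <-> sg_supp b;
  sg_mult_swap : forall b, sg_mult b = sg_mult (pair_swap b)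
}.

Section spectral_geometry_theory.
Context {R : realType} {X : metricType R} (M : spectral_geometry X).

(* A section of the bundle with fibres C^(m b) is the family of its
   coordinates, indexed by the pairs (b, i) with i < m b; as m vanishes off
   the support, only the b in the support contribute. *)
Definition sg_index : choiceType := {b : X * X & 'I_(sg_mult M b)}.

Definition sg_section := sg_index -> R[i].

Definition sg_hilbert : set sg_section := @l2 R sg_index.

Definition sg_algebra : set (X -> R[i]) :=
  [set a | exists K : R,
     forall x y, `|a x - a y| <= (K * mdist x y)%:C].

Definition sg_rep (a : X -> R[i]) (xi : sg_section) : sg_section :=
  fun s => a (tag s).1 * xi s.

Definition sg_index_swap (s : sg_index) : sg_index :=
  Tagged (fun b => 'I_(sg_mult M b))
    (cast_ord (sg_mult_swap M (tag s)) (tagged s)).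

Definition sg_ds (xi : sg_section) : sg_section :=
  fun s => (pair_length (tag s))%:C * xi (sg_index_swap s).

(* The explicit 0 accounts for the convention sup set0 = 0. *)
Definition sg_dim (w : (nat -> R) -> R) : \bar R :=
  ereal_sup (0%E |` [set p%:E | p in [set p : R |
    0 <= p /\ dixmier_trace w (pow_op (abs_op sg_ds) p) = +oo%E]]).

End spectral_geometry_theory.

Section bounding_radius.
Context {R : realType} {X : metricType R}.
Implicit Types (B : set (X * X)) (t : R).

Definition long_points B t : set X := fst @` long_pairs B t.

Definition covering_radius B t : \bar R :=
  ereal_inf [set delta%:E | delta in [set delta : R | 0 < delta /\
    [set: X] `<=`
      \bigcup_(y in long_points B t) [set x | mdist y x <= delta]]].

Definition rel_bounding_radius B : \bar R :=
  limf_esup (fun t => covering_radius B t * (t^-1)%:E)%E (0 : R)^'+.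

End bounding_radius.

(* Main.v *)
(* On sections, |ds| is multiplication by the length |b|, so |ds|^p is
   multiplication by |b|^p, and for p > 0 the N-th largest eigenvalue of |ds|^p
   is at least t^p as soon as the support B has N pairs of length at least t.
   If p > dim M, the eigenvalue sums are O(log N), so N = #B_t satisfies
   N t^p <= C log N, hence N = O(t^(-r)) for every r > p.  Since nu(B) is
   finite, for all small t the space is covered by at most N balls of radius
   c t, and the q-dimensional Hausdorff premeasures, bounded by
   N (2 c t)^q = O(t^(q - r)), vanish for q > r. *)
Require Import Defs.
From mathcomp Require Import all_boot all_order all_algebra.
From mathcomp Require Import all_classical all_reals all_analysis.
From mathcomp Require Import finmap complex.
From mathcomp Require Import ring lra.

Set Implicit Arguments.
Unset Strict Implicit.
Unset Printing Implicit Defensive.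

Import Order.TTheory GRing.Theory Num.Theory.
Import numFieldTopology.Exports numFieldNormedType.Exports.

Local Open Scope classical_set_scope.
Local Open Scope ring_scope.
Local Open Scope complex_scope.

(** * Unordered sums over an arbitrary index type *)

Section sums.
Context {R : realType} {I : choiceType}.
Implicit Types (f g h : I -> R) (F : seq I) (k : R).

Lemma esum_seq F h : uniq F -> (forall i, 0 <= h i) ->
  (forall i, i \notin F -> h i = 0) ->
  (\esum_(i in [set: I]) (h i)%:E)%E = (\sum_(i <- F) h i)%:E.
Proof.
move=> uF h0 hF.
transitivity (\esum_(i in [set` F]) (h i)%:E)%E.
  rewrite [RHS]esum_mkcond; apply: eq_esum => i _.
  by rewrite mem_setE; case: ifPn => // /hF ->.
rewrite esum_fset//; last by move=> i _; rewrite lee_fin.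
rewrite fsbig_finite//= -sumEFin.
apply: perm_big; apply: uniq_perm => // i.

by rewrite in_fset_set// mem_setE.
Qed.

Lemma le_esumZ f g k : 0 <= k -> (forall i, 0 <= g i) ->
  (forall i, f i <= k * g i) ->
  (\esum_(i in [set: I]) (f i)%:E <=
   k%:E * \esum_(i in [set: I]) (g i)%:E)%E.
Proof.
move=> k0 g0 fg; apply: ge_ereal_sup => _ [A [finA _] <-].
apply: (@le_trans _ _ (k%:E * \sum_(i \in A) (g i)%:E)%E).
  rewrite !fsbig_finite//= !sumEFin -EFinM lee_fin mulr_sumr.
  exact: ler_sum.
apply: lee_wpmul2l; rewrite ?lee_fin//.
by apply: ereal_sup_ubound; exists A.
Qed.

Lemma esum_ge_term f i : (forall i, 0 <= f i) ->
  ((f i)%:E <= \esum_(j in [set: I]) (f j)%:E)%E.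
Proof.
move=> f0; apply: esum_ge; exists [set i]; first by split.
by rewrite fsbig_set1.
Qed.

(** A finite partial sum within [e] of the supremum leaves a remainder of at most [e], and adding
    [s] to it only shrinks the remainder. Having [s] in [F] makes the tail vanish at the coordinate
    studied in [diag_op]. *)
Lemma esum_tail f (e : R) s : 0 < e -> (forall i, 0 <= f i) ->
  (\esum_(i in [set: I]) (f i)%:E < +oo)%E ->
  exists F, [/\ uniq F, s \in F &
   (\esum_(i in [set: I]) (if i \in F then 0 else f i)%:E <= e%:E)%E].
Proof.
move=> e0 f0 foo.
have ffin : (\esum_(i in [set: I]) (f i)%:E)%E \is a fin_num.
  by rewrite ge0_fin_numE//; apply: esum_ge0 => i _; rewrite lee_fin.
have [_ [A [finA _] <-] ltA] := ub_ereal_sup_adherent e0 ffin.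
pose F := undup (s :: fset_set A).
exists F; split; [exact: undup_uniq| by rewrite mem_undup mem_head|].
have eq1 : (\esum_(i in [set: I]) (f i)%:E = (\sum_(i <- F) f i)%:E +
    \esum_(i in [set: I]) (if i \in F then 0 else f i)%:E)%E.
  have -> : \sum_(i <- F) f i = \sum_(i <- F) if i \in F then f i else 0.
    by apply: eq_big_seq => i ->.
  rewrite -(@esum_seq F (fun i => if i \in F then f i else 0)) ?undup_uniq//.
  - rewrite -esumD.
    + apply: eq_esum => i _; rewrite -EFinD.
      by case: ifP => _; rewrite ?addr0 ?add0r.
    + by move=> i _; case: ifP => _; rewrite lee_fin.
    + by move=> i _; case: ifP => _; rewrite lee_fin.
  - by move=> i; case: ifP.
  - by move=> i /negbTE ->.
move: ltA ffin; rewrite -/(esum _ _) eq1 fsbig_finite//= sumEFin.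
have leF : \sum_(i <- fset_set A) f i <= \sum_(i <- F) f i.
  rewrite [leRHS](bigID (mem A))/= -[leLHS]addr0 lerD ?sumr_ge0//.
  rewrite -[leRHS]big_filter le_eqVlt; apply/orP; left; apply/eqP.
  apply: perm_big; apply: uniq_perm; rewrite ?fset_uniq ?filter_uniq ?undup_uniq//.
  move=> i; rewrite mem_filter mem_undup inE in_fset_set//.
  by case: (boolP (i \in A)); rewrite ?orbT.
set S := (esum _ _).
case: S => [r| |]//=.
rewrite -EFinB -EFinD lte_fin lee_fin => ltA _; lra.
Qed.

Lemma rsum_seq F g : uniq F -> (forall i, i \notin F -> g i = 0) ->
  rsum g = \sum_(i <- F) g i.
Proof.
move=> uF gF; rewrite /rsum !(@esum_seq F)//=.
- rewrite -sumrB; apply: eq_bigr => i _.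
  have [g0|g0] := leP 0 (g i).
    by rewrite max_r ?subr0// oppr_le0.
  by rewrite max_l ?oppr_ge0 ?sub0r ?opprK// ltW.
- by move=> i; rewrite le_max lexx orbT.
- by move=> i /gF ->; rewrite oppr0 maxxx.
- by move=> i; rewrite le_max lexx orbT.
- by move=> i /gF ->; rewrite maxxx.
Qed.

Lemma rsum_reindex (e : I -> I) g : involutive e ->
  rsum (fun i => g (e i)) = rsum g.
Proof.
move=> eK; have bij : set_bij [set: I] [set: I] e.
  split=> //; first by move=> i j _ _ /(can_inj eK).
  by move=> i _; exists (e i).
by rewrite /rsum (@reindex_esum _ _ _ _ _ e (fun i => (Num.max (g i) 0)%:E) bij)
  (@reindex_esum _ _ _ _ _ e (fun i => (Num.max (- g i) 0)%:E) bij).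
Qed.

Lemma rsum_ge0 g : (forall i, 0 <= g i) -> 0 <= rsum g.
Proof.
move=> g0; rewrite /rsum [X in _ - fine X]esum1; last first.
  by move=> i _; rewrite max_r// oppr_le0.
by rewrite subr0 fine_ge0// esum_ge0// => i _; rewrite lee_fin le_max lexx orbT.
Qed.

Lemma rsum0 : rsum (fun _ : I => 0 : R) = 0.
Proof. by rewrite (@rsum_seq [::])// big_nil. Qed.

(** Only the negative part contributes, so [fine] of the sum of the [- g i] is at most 0. Finiteness
    matters here: [fine] also sends [+oo] to 0. *)
Lemma rsum_le0_eq0 g : (forall i, g i <= 0) -> 0 <= rsum g ->
  (\esum_(i in [set: I]) (- g i)%:E < +oo)%E -> forall i, g i = 0.
Proof.
move=> g0 + goo i.
rewrite /rsum [X in fine X - _]esum1; last by move=> j _; rewrite max_r.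
have eqE : (\esum_(i in [set: I]) (Num.max (- g i) 0)%:E =
    \esum_(i in [set: I]) (- g i)%:E)%E.
  by apply: eq_esum => j _; rewrite max_l// oppr_ge0.
rewrite eqE sub0r oppr_ge0 => le0.
have ge0 j : 0 <= - g j by rewrite oppr_ge0.
have := @esum_ge_term (fun i => - g i) i ge0.
move: goo le0; set S := esum _ _.
have : (0 <= S)%E by apply: esum_ge0 => j _; rewrite lee_fin.
case: S => [r| |]//=; rewrite !lee_fin => r0 _ r0' gir.
apply/eqP; rewrite eq_le g0/=; lra.
Qed.

End sums.

(** * Square-summable families and bounded operators on them *)

Section l2_theory.
Context {R : realType} {I : choiceType}.
Implicit Types (xi eta : I -> R[i]) (T S : (I -> R[i]) -> (I -> R[i])).
Implicit Types (F : seq I) (i : I).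

(** Convertible to the summand of [l2norm2]; its values lie in [R], whereas those of the norm on
    [R[i]] lie in [R[i]]. *)
Definition normsq (z : R[i]) : R := complex.Re z ^+ 2 + complex.Im z ^+ 2.

Lemma normsq_ge0 z : 0 <= normsq z.
Proof. by rewrite /normsq addr_ge0// sqr_ge0. Qed.

Lemma normsq_eq0 z : normsq z = 0 -> z = 0.
Proof.
case: z => x y; rewrite /normsq/= => /eqP.
by rewrite paddr_eq0 ?sqr_ge0// !sqrf_eq0 => /andP[/eqP-> /eqP->].
Qed.

Lemma normsq0 : normsq 0 = 0.
Proof. by rewrite /normsq/= expr0n addr0. Qed.

Lemma normsqM y z : normsq (y * z) = normsq y * normsq z.
Proof. by case: y z => [a b] [c d]; rewrite /normsq/=; ring. Qed.

Lemma normsq_real (x : R) : normsq x%:C = x ^+ 2.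
Proof. by rewrite /normsq/= expr0n addr0. Qed.

Lemma conj_mul z : conjc z * z = (normsq z)%:C.
Proof.
by case: z => a b; apply/eqP; rewrite eq_complex /normsq/=; apply/andP; split;
  apply/eqP; ring.
Qed.

Lemma conjc_realM (x : R) z : conjc (x%:C * z) = x%:C * conjc z.
Proof.
case: z => u v; apply/eqP; rewrite eq_complex/= !mul0r.
by apply/andP; split; apply/eqP; ring.
Qed.

(** Parallelogram identity with the term [normsq (y - z)] dropped. *)
Lemma normsqD_le y z : normsq (y + z) <= 2 * normsq y + 2 * normsq z.
Proof.
have := normsq_ge0 (y - z).
by case: y z => [a b] [c d]; rewrite /normsq/=; lra.
Qed.

Lemma l2_lin (a : R[i]) xi eta : l2 xi -> l2 eta ->
  l2 (fun i => a * xi i + eta i).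
Proof.
rewrite /l2/= /l2norm2 => lx le.
pose f i := 2 * normsq a * normsq (xi i).
pose g i := 2 * normsq (eta i).
have f0 i : 0 <= f i by rewrite !mulr_ge0// normsq_ge0.
have g0 i : 0 <= g i by rewrite mulr_ge0// normsq_ge0.
apply: (@le_lt_trans _ _
  (\esum_(i in [set: I]) ((f i)%:E + (g i)%:E))%E).
  apply: le_esum => i _; rewrite -EFinD lee_fin.
  by have := normsqD_le (a * xi i) (eta i); rewrite normsqM mulrA.
rewrite esumD; last 2 first.
- by move=> i _; rewrite lee_fin.
- by move=> i _; rewrite lee_fin.
apply: lte_add_pinfty.
  apply: le_lt_trans (@le_esumZ _ _ f (normsq \o xi) (2 * normsq a) _ _ _) _ => //.
  - by rewrite mulr_ge0// normsq_ge0.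
  - by move=> i; exact: normsq_ge0.
  - by rewrite lte_mul_pinfty// lee_fin mulr_ge0// normsq_ge0.
apply: le_lt_trans (@le_esumZ _ _ g (normsq \o eta) 2 _ _ _) _ => //.
- by move=> i; exact: normsq_ge0.
- by rewrite lte_mul_pinfty.
Qed.

Lemma l2_seq F xi : uniq F -> (forall i, i \notin F -> xi i = 0) -> l2 xi.
Proof.
move=> uF xF; rewrite /l2/= /l2norm2 (@esum_seq _ _ F (normsq \o xi)) ?ltry//.
- by move=> i; exact: normsq_ge0.
- by move=> i /xF /= ->; exact: normsq0.
Qed.

Lemma l2_0 : l2 (fun _ : I => 0 : R[i]).
Proof. exact: (@l2_seq [::]). Qed.

Lemma csum_seq F (f : I -> R[i]) : uniq F ->
  (forall i, i \notin F -> f i = 0) ->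
  csum f = \sum_(i <- F) f i.
Proof.
move=> uF fF; rewrite /csum !(@rsum_seq _ _ F)//; last 2 first.
- by move=> i /fF ->.
- by move=> i /fF ->.
elim: (F) => [|i s ih]; first by rewrite !big_nil.
by rewrite !big_cons -ih; case: (f i).
Qed.

Lemma l2dot_seq F xi eta : uniq F ->
  (forall i, i \notin F -> conjc (xi i) * eta i = 0) ->
  l2dot xi eta = \sum_(i <- F) conjc (xi i) * eta i.
Proof. exact: csum_seq. Qed.

Definition mul_op (a : I -> R) xi : I -> R[i] := fun i => (a i)%:C * xi i.

(** Every term is [a i] times a squared modulus, hence real. Positivity questions thereby reduce to
    real sums. *)
Lemma l2dot_mul_op (a : I -> R) xi : l2dot xi (mul_op a xi) =
  (rsum (fun i => a i * normsq (xi i)))%:C.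
Proof.
rewrite /l2dot /csum.
have E i : conjc (xi i) * mul_op a xi i = (a i * normsq (xi i))%:C.
  by rewrite /mul_op mulrCA conj_mul rmorphM.
have -> : (fun i => complex.Im (conjc (xi i) * mul_op a xi i)) = (fun=> 0).
  by apply/funext => i; rewrite E.
have -> : (fun i => complex.Re (conjc (xi i) * mul_op a xi i)) =
    (fun i => a i * normsq (xi i)).
  by apply/funext => i; rewrite E.
by rewrite rsum0.
Qed.

Definition l2delta i : I -> R[i] := fun j => (j == i)%:R.

Lemma l2_delta i : l2 (l2delta i).
Proof.
apply: (@l2_seq [:: i]) => // j; rewrite inE /l2delta => /negbTE ->.
exact: mulr0n.
Qed.

Lemma l2dot_deltal i eta : l2dot (l2delta i) eta = eta i.
Proof.
rewrite (@l2dot_seq [:: i])//.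
  by rewrite big_seq1 /l2delta eqxx conjc1 mul1r.
by move=> j; rewrite inE /l2delta => /negbTE ->; rewrite conjc0 mul0r.
Qed.

Lemma bounded_op0 T : bounded_op T -> T (fun=> 0) = (fun=> 0).
Proof.
move=> [linT _]; have := linT 1 _ _ l2_0 l2_0.
rewrite (_ : (fun _ : I => 1 * 0 + 0) = (fun=> 0 : R[i])); last first.
  by apply/funext => i; rewrite mulr0 addr0.
move=> e; apply/funext => i; move/(congr1 (fun f => f i)): e.
by rewrite mul1r -[LHS]addr0 => /addrI.
Qed.

Lemma bounded_op_bound T : bounded_op T -> exists2 K : R, 0 <= K &
  forall xi, l2 xi -> (l2norm2 (T xi) <= K%:E * l2norm2 xi)%E.
Proof.
move=> [_ [K TK]]; exists `|K| => // xi lx; apply: le_trans (TK _ lx) _.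
apply: lee_wpmul2r; last by rewrite lee_fin ler_norm.
by apply: esum_ge0 => i _; rewrite lee_fin; exact: normsq_ge0.
Qed.

Lemma bounded_op_l2 T xi : bounded_op T -> l2 xi -> l2 (T xi).
Proof.
move=> /bounded_op_bound[K K0 TK] lx; apply: le_lt_trans (TK _ lx) _.
by rewrite lte_mul_pinfty.
Qed.

Lemma bounded_opD T xi eta : bounded_op T -> l2 xi -> l2 eta ->
  T (fun i => xi i + eta i) = (fun i => T xi i + T eta i).
Proof.
move=> [linT _] lx le; have := linT 1 _ _ lx le.
under eq_fun do rewrite mul1r.
by move=> ->; apply/funext => i; rewrite mul1r.
Qed.

(** Induction on the finite support: linearity splits off one coordinate at a time. *)
Lemma diag_op_seq T (a : I -> R[i]) F xi : bounded_op T ->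
  (forall i, T (l2delta i) = (fun j => a j * l2delta i j)) -> uniq F ->
  (forall i, i \notin F -> xi i = 0) ->
  T xi = (fun i => a i * xi i).
Proof.
move=> bT Td; elim: F xi => [|i F ih] xi /=.
  move=> _ x0; have -> : xi = (fun=> 0) by apply/funext => i; exact: x0.
  by rewrite (bounded_op0 bT); apply/funext => i; rewrite mulr0.
move=> /andP[iF uF] xF.
pose eta j := if j == i then 0 else xi j.
have etaF j : j \notin F -> eta j = 0.
  move=> jF; rewrite /eta; case: (eqVneq j i) => // ji.
  by apply: xF; rewrite inE negb_or ji.
have -> : xi = (fun j => xi i * l2delta i j + eta j).
  apply/funext => j; rewrite /eta /l2delta; case: eqP => [->|_].
    by rewrite mulr1 addr0.
  by rewrite mulr0 add0r.
rewrite bT.1; [|exact: l2_delta|exact: l2_seq etaF].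
rewrite (ih eta)// Td; apply/funext => j.
by rewrite mulrDr mulrCA.
Qed.

(* At each coordinate s, T xi is determined up to an arbitrarily small error by
   a finite truncation of xi containing s, to which diag_op_seq applies. *)
Lemma diag_op T (a : I -> R[i]) xi : bounded_op T ->
  (forall i, T (l2delta i) = (fun j => a j * l2delta i j)) -> l2 xi ->
  T xi = (fun i => a i * xi i).
Proof.
move=> bT Td lx; have [K K0 TK] := bounded_op_bound bT.
apply/funext => s; apply/eqP; rewrite -subr_eq0; apply/eqP; apply: normsq_eq0.
apply/eqP; rewrite eq_le normsq_ge0 andbT; apply/ler_addgt0Pr => e e0.
rewrite add0r.
(* The [+ 1] keeps the denominator positive when [K = 0], and [K * (e / (K + 1)) <= e]. *)
have e1 : 0 < e / (K + 1) by rewrite divr_gt0// ltr_wpDl.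
have [F [uF sF tailF]] := @esum_tail _ _ (normsq \o xi) _ s e1
  (fun i => normsq_ge0 _) lx.
pose hd i := if i \in F then xi i else 0.
pose tl i := if i \in F then 0 else xi i.
have hdF i : i \notin F -> hd i = 0 by rewrite /hd => /negbTE ->.
have lh : l2 hd by exact: l2_seq uF hdF.
have tlle : (l2norm2 tl <= (e / (K + 1))%:E)%E.
  apply: le_trans tailF; apply: le_esum => i _; rewrite lee_fin /tl/=.
  by case: ifP => // _; rewrite expr0n addr0.
have lt : l2 tl by apply: le_lt_trans tlle _; exact: ltry.
have -> : xi = (fun i => hd i + tl i).
  by apply/funext => i; rewrite /hd /tl; case: ifP; rewrite ?addr0 ?add0r.
rewrite (bounded_opD bT)// (diag_op_seq bT Td uF hdF) /=.
(* As [s] lies in [F], the tail vanishes at [s], and the difference to estimate is [T tl s]. *)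
rewrite {2}/tl sF addr0 addrAC subrr add0r.
have : ((normsq (T tl s))%:E <= K%:E * (e / (K + 1))%:E)%E.
  apply: le_trans (@esum_ge_term _ _ (normsq \o T tl) s _) _.
    by move=> i; exact: normsq_ge0.
  by apply: le_trans (TK _ lt) _; apply: lee_wpmul2l; rewrite ?lee_fin.
rewrite -EFinM lee_fin => /le_trans; apply.
rewrite mulrCA ler_piMr//; first exact: ltW.
by rewrite ler_pdivrMr ?mul1r ?ltr_wpDl// lerDl.
Qed.

Lemma l2_mul_op (a : I -> R) (C : R) xi : (forall i, `|a i| <= C) ->
  (l2norm2 (mul_op a xi) <= (C ^+ 2)%:E * l2norm2 xi)%E.
Proof.
move=> aC; apply: (@le_esumZ _ _ _ (normsq \o xi)).
- by rewrite sqr_ge0.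
- by move=> i; exact: normsq_ge0.
move=> i; rewrite -/(normsq _) normsqM normsq_real ler_wpM2r ?normsq_ge0//.
by rewrite -real_normK ?num_real// lerXn2r ?nnegrE//; exact: le_trans (aC i).
Qed.

Lemma bounded_mul_op (a : I -> R) (C : R) : (forall i, `|a i| <= C) ->
  bounded_op (mul_op a).
Proof.
move=> aC; split.
  by move=> c xi eta _ _; apply/funext => i; rewrite /mul_op mulrDr mulrCA.
by exists (C ^+ 2) => xi _; exact: l2_mul_op.
Qed.

Lemma l2norm2_reindex (e : I -> I) xi : involutive e ->
  l2norm2 (fun i => xi (e i)) = l2norm2 xi.
Proof.
move=> eK; have bij : set_bij [set: I] [set: I] e.
  split=> //; first by move=> i j _ _ /(can_inj eK).
  by move=> i _; exists (e i).
rewrite /l2norm2.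
by rewrite (@reindex_esum _ _ _ _ _ e (fun i => (normsq (xi i))%:E) bij).
Qed.

(** Pairing [xi] with [S xi] gives [- l] times the squared norm of [xi], which positivity forces to
    be 0. *)
Lemma positive_op_neg_eigen S (l : R) xi : positive_op S -> 0 < l -> l2 xi ->
  S xi = (fun i => (- l)%:C * xi i) -> xi = (fun=> 0).
Proof.
move=> pS l0 lx Sx; have := pS _ lx.
rewrite Sx (l2dot_mul_op (fun=> - l)) ler0c => h.
apply/funext => i; apply: normsq_eq0.
have le0 j : - l * normsq (xi j) <= 0.
  by rewrite mulNr oppr_le0 mulr_ge0 ?normsq_ge0// ltW.
have /= /(_ _ i)/eqP := rsum_le0_eq0 le0 h.
rewrite mulf_eq0 oppr_eq0 gt_eqF//= => h'; apply/eqP; apply: h'.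
under eq_esum do rewrite -mulNr opprK.
apply: le_lt_trans (@le_esumZ _ _ _ (normsq \o xi) l _ _ _) _ => //.
- exact: ltW.
- by move=> j; exact: normsq_ge0.
- by rewrite lte_mul_pinfty// lee_fin ltW.
Qed.

End l2_theory.

(** * The absolute value of a weighted swap, and its powers *)

Section multiplication_operators.
Context {R : realType} {I : choiceType}.
Implicit Types (xi eta : I -> R[i]) (T S : (I -> R[i]) -> (I -> R[i])).

Section absolute_value.
Variables (a : I -> R) (C : R) (s : I -> I).
Hypotheses (a0 : forall i, 0 < a i) (aC : forall i, a i <= C)
  (sK : involutive s) (as_ : forall i, a (s i) = a i).

(** Abstract form of [sg_ds]: [a] stands for the lengths and [s] for the swap of the indices. *)
Let flip_op xi : I -> R[i] := fun i => (a i)%:C * xi (s i).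

Let abs_aC i : `|a i| <= C.
Proof. by rewrite gtr0_norm. Qed.

Let flip_opE xi : flip_op xi = mul_op a (fun i => xi (s i)).
Proof. by []. Qed.

Let bounded_flip : bounded_op flip_op.
Proof.
split.
  by move=> c xi eta _ _; apply/funext => i; rewrite /flip_op mulrDr mulrCA.
exists (C ^+ 2) => xi _; rewrite flip_opE -(l2norm2_reindex xi sK).
exact: l2_mul_op.
Qed.

(** Reindexing by [s], which preserves the real weight [a], moves the swap from one factor to the
    other. *)
Let flip_adjoint : is_adjoint flip_op flip_op.
Proof.
move=> xi eta _ _; rewrite /l2dot /csum.
pose f i := conjc (flip_op xi i) * eta i.
have E i : conjc (xi i) * flip_op eta i = f (s i).
  by rewrite /f /flip_op as_ sK conjc_realM mulrCA mulrA.
rewrite -(rsum_reindex (fun i => complex.Re (f i)) sK).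
rewrite -(rsum_reindex (fun i => complex.Im (f i)) sK).
by under [in RHS]eq_fun do rewrite E; congr Complex;
  congr rsum; apply/funext => i; rewrite E.
Qed.

(* The vector u = S delta - a delta satisfies S u = - a u because S^2 = a^2, so
   positivity of S forces u = 0. *)
Lemma abs_opE : bounded_op (abs_op flip_op) /\
  forall xi, l2 xi -> abs_op flip_op xi = mul_op a xi.
Proof.
have : [set S | [/\ bounded_op S, positive_op S &
    exists2 T', bounded_op T' /\ is_adjoint flip_op T' &
      forall xi, l2 xi -> S (S xi) = T' (flip_op xi)]] (mul_op a).
  split; first exact: bounded_mul_op abs_aC.
    move=> xi _; rewrite l2dot_mul_op ler0c; apply: rsum_ge0 => i.
    by rewrite mulr_ge0 ?normsq_ge0// ltW.
  exists flip_op => // xi _; apply/funext => i.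
  by rewrite /mul_op /flip_op as_ sK.
(* [abs_op] is an arbitrary choice among the operators meeting its specification. With [mul_op a]
   showing that one exists, the values of the chosen [S] are derived from the specification
   alone. *)
move=> /(xgetI (fun=> cst 0)); rewrite -/(abs_op _).
set S := abs_op _ => -[bS pS [T' [bT' adjT'] SS]]; split => //.
have SSE xi : l2 xi -> S (S xi) = (fun i => (a i ^+ 2)%:C * xi i).
  move=> lx; rewrite SS//; apply/funext => i.
  (* [T'] is known only through the adjoint relation, so its coordinate [i] is read off by pairing
     with [l2delta i]. *)
  rewrite -[LHS]l2dot_deltal -adjT'; [|exact: l2_delta|exact: bounded_op_l2].
  have flip_delta : flip_op (l2delta i) = (fun j => (a i)%:C * l2delta (s i) j).
    apply/funext => j; rewrite /flip_op /l2delta (can2_eq sK sK).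
    by case: eqP => [->|_]; rewrite ?as_// !mulr0.
  rewrite flip_delta (@l2dot_seq _ _ [:: s i])//.
    rewrite big_seq1 conjc_realM /l2delta eqxx conjc1 mulr1 /flip_op as_ sK.
    by rewrite mulrA -rmorphM.
  by move=> j; rewrite inE /l2delta => /negbTE ->; rewrite mulr0 conjc0 mul0r.
move=> xi; apply: diag_op => // i.
have ld := l2_delta i : l2 (l2delta i : I -> R[i]).
have lSd := bounded_op_l2 bS ld.
pose u j := (- (a i)%:C) * l2delta i j + S (l2delta i) j.
have lu : l2 u by exact: l2_lin.
have deltaE (f : I -> R[i]) j : f j * l2delta i j = f i * l2delta i j.
  by rewrite /l2delta; case: eqP => [->//|_]; rewrite !mulr0.
have Su : S u = (fun j => (- a i)%:C * u j).
  rewrite /u bS.1// SSE//; apply/funext => j.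
  rewrite (deltaE (fun j => (a j ^+ 2)%:C)) rmorphN rmorphXn/= expr2.
  by ring.
have u0 := positive_op_neg_eigen pS (a0 i) lu Su.
apply/funext => j; rewrite (deltaE (fun j => (a j)%:C)); apply/eqP.
by rewrite -subr_eq0 addrC -mulNr; apply/eqP; move/(congr1 (fun f => f j)): u0.
Qed.

End absolute_value.

(** The vectors [l2delta i] are eigenvectors with eigenvalue [a i], so the specification of [pow_op]
    fixes its values there, and [diag_op] extends this to all of [l2]. *)
Lemma pow_opE T (a : I -> R) (C p : R) : bounded_op T -> 0 <= p ->
  (forall i, 0 < a i) -> (forall i, a i <= C) ->
  (forall xi, l2 xi -> T xi = mul_op a xi) ->
  bounded_op (pow_op T p) /\
  forall xi, l2 xi -> pow_op T p xi = mul_op (fun i => a i `^ p) xi.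
Proof.
move=> bT p0 a0 aC TE.
have : [set S | bounded_op S /\
    forall (l : R) xi, eigenvector T l xi ->
      S xi = (fun i => (l `^ p)%:C * xi i)]
    (mul_op (fun i => a i `^ p)).
  split.
    apply: (@bounded_mul_op _ _ _ (C `^ p)) => i.
    rewrite ger0_norm ?powR_ge0// ge0_ler_powR// nnegrE.
      exact: ltW.
    exact: le_trans (ltW (a0 i)) (aC i).
  (* An eigenvector for [l] is supported where [a i = l]. *)
  move=> l xi [lx]; rewrite TE// => Txi; apply/funext => i; rewrite /mul_op.
  have [->|xi0] := eqVneq (xi i) 0; first by rewrite !mulr0.
  by move/(congr1 (fun f => f i)): Txi => /(mulIf xi0)/complexI ->.
move=> /(xgetI (fun=> cst 0)); rewrite -/(pow_op _ _).
set S := pow_op _ _ => -[bS Seig]; split => // xi.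
apply: diag_op => // i.
have deltaE (f : I -> R[i]) j : f j * l2delta i j = f i * l2delta i j.
  by rewrite /l2delta; case: eqP => [->//|_]; rewrite !mulr0.
rewrite (Seig (a i)).
  by apply/funext => j; rewrite -(deltaE (fun j => (a j `^ p)%:C)).
split; first exact: l2_delta.
rewrite TE; last exact: l2_delta.
by apply/funext => j; rewrite -(deltaE (fun j => (a j)%:C)).
Qed.

End multiplication_operators.

(** * Enumeration of the indices by decreasing weight *)

Section decreasing_enumeration.
Context {R : realType} {I : choiceType} (a : I -> R).
Hypotheses (a0 : forall i, 0 < a i)
  (afin : forall t : R, 0 < t -> finite_set [set i | t <= a i]).

Lemma seq_argmax (i0 : I) (s : seq I) :
  exists2 i, i \in i0 :: s & forall j, j \in i0 :: s -> a j <= a i.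
Proof.
elim: s i0 => [|i1 s ih] i0.
  by exists i0; rewrite ?mem_head// => j; rewrite inE => /eqP ->.
have [i iin imax] := ih i1; have [le01|lt10] := leP (a i0) (a i).
  exists i; first by rewrite inE iin orbT.
  by move=> j; rewrite inE => /orP[/eqP ->//|/imax].
exists i0; rewrite ?mem_head// => j; rewrite inE => /orP[/eqP ->//|/imax].
by move=> /le_trans; apply; exact: ltW.
Qed.

Let is_next (s : seq I) i := i \notin s /\ forall j, j \notin s -> a j <= a i.

(** [None] occurs only when [s] already lists all of [I], as [next_exists] shows. *)
Let next (s : seq I) : option I :=
  if pselect (exists i, is_next s i) is left h then Some (projT1 (cid h))
  else None.

Let nextP s i : next s = Some i -> is_next s i.
Proof.
by rewrite /next; case: pselect => // h [<-]; case: cid.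
Qed.

Let next_exists s j : j \notin s -> exists i, next s = Some i.
Proof.
move=> js; rewrite /next; case: pselect => [h|[]].
  by exists (projT1 (cid h)).
have fA := afin (a0 j).
(* Only the finitely many unlisted indices of weight at least [a j] compete for the maximum; all
   other unlisted ones lie below [a j]. *)
pose A := [seq i <- fset_set [set i | a j <= a i] | i \notin s].
have AP i : (i \in A) = (i \notin s) && (a j <= a i).
  by rewrite mem_filter in_fset_set// mem_setE.
have [i iA imax] := seq_argmax j A.
move: iA; rewrite inE => iA; exists i; split.
  by case/orP: iA => [/eqP ->//|]; rewrite AP => /andP[].
move=> k ks; have [le_|lt_] := leP (a j) (a k).
  by apply: imax; rewrite inE AP ks le_ orbT.
by rewrite (le_trans (ltW lt_))// imax// mem_head.
Qed.

Fixpoint greedy_seq n : seq I :=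
  if n is m.+1 then
    if next (greedy_seq m) is Some i then i :: greedy_seq m else greedy_seq m
  else [::].

Let greedy_seq_sub m n i : (m <= n)%N ->
  i \in greedy_seq m -> i \in greedy_seq n.
Proof.
move=> /subnK <-; elim: (n - m)%N => // k ih im.
by rewrite addSn /=; case: next => [j|]; rewrite ?inE ih ?orbT.
Qed.

Let next_mem_greedy_seq m n i : (m < n)%N ->
  next (greedy_seq m) = Some i -> i \in greedy_seq n.
Proof.
by move=> mn e; apply: (greedy_seq_sub mn); rewrite /= e mem_head.
Qed.

(** Greedy choice: each stage takes an unlisted index of maximal weight. The values lie in
    [option I] because [I] may be finite, in which case the enumeration ends with [None]. *)
Lemma decreasing_enumeration : exists f : nat -> option I,
  [/\ forall i, exists n, f n = Some i,
      forall m n i, f m = Some i -> f n = Some i -> m = n &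
      forall m n j, (m <= n)%N -> f n = Some j ->
        exists2 i, f m = Some i & a j <= a i].
Proof.
exists (fun n => next (greedy_seq n)); split.
- move=> i; apply: contrapT => /forallNP ni.
  have notin n : i \notin greedy_seq n.
    elim: n => //= n ih; case e: (next (greedy_seq n)) => [j|//].
    rewrite inE negb_or ih andbT; apply/eqP => ij.
    by apply: (ni n); rewrite e ij.
  have fA := afin (a0 i).
  pose A := fset_set [set j | a i <= a j].
  (* If [i] is never listed, every chosen index has weight at least [a i]; one stage more than the
     cardinality of [A] is then too many. *)
  have [uc sc cA] : [/\ uniq (greedy_seq #|` A|.+1),
      size (greedy_seq #|` A|.+1) = #|` A|.+1 &
      {subset greedy_seq #|` A|.+1 <= A}].
    elim: #|` A|.+1 => // n [un sn subn] /=.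
    have [j ej] := next_exists (notin n); rewrite ej/= un sn.
    have [jn jmax] := nextP ej; rewrite jn; split=> // k.
    rewrite inE => /orP[/eqP ->|/subn//].
    by rewrite in_fset_set// mem_setE /=; exact: jmax.
  by have := uniq_leq_size uc cA; rewrite sc ltnn.
- move=> m n i em en; case: (ltngtP m n) => // lt.
    by have [] := nextP en; rewrite (next_mem_greedy_seq lt em).
  by have [] := nextP em; rewrite (next_mem_greedy_seq lt en).
- move=> m n j mn en; have [jn _] := nextP en.
  have jm : j \notin greedy_seq m by apply: contra jn; exact: greedy_seq_sub.
  have [i ei] := next_exists jm; exists i => //.
  by have [_] := nextP ei; exact.
Qed.

End decreasing_enumeration.

(** * Eigenvalue sequences of multiplication operators *)

Section eigenvalues_of_multiplication.
Context {R : realType} {I : choiceType} (a : I -> R).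
Variable T : (I -> R[i]) -> (I -> R[i]).
Hypotheses (a0 : forall i, 0 < a i)
  (TE : forall xi, l2 xi -> T xi = mul_op a xi).

(** The enumerated weights, padded with 0, form an eigenvalue sequence with eigenvectors
    [l2delta i], so the choice made in [eigenvalues] meets its specification. That suffices, since
    [eigenvalue_ge] holds for every such sequence. *)
Lemma eigenvaluesP :
  (forall t : R, 0 < t -> finite_set [set i | t <= a i]) ->
  is_eigenvalue_seq T (eigenvalues T).
Proof.
move=> afin; have [f [fsurj finj fdecr]] := decreasing_enumeration a0 afin.
rewrite /eigenvalues.
apply: (@xgetPex _ (cst 0) [set mu | is_eigenvalue_seq T mu]).
pose mu n := if f n is Some i then a i else 0.
exists mu; split.
- by move=> n; rewrite /mu; case: (f n) => // i; exact: ltW.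
- move=> m n mn; rewrite /mu; case en: (f n) => [j|].
    by have [i -> le_] := fdecr _ _ _ mn en.
  by case: (f m) => // i; exact: ltW.
exists (fun n => if f n is Some i then l2delta i else cst 0); split.
- move=> n; rewrite /mu; case: (f n) => [i _|]; last by rewrite ltxx.
  split; first exact: l2_delta.
  rewrite TE; last exact: l2_delta.
  apply/funext => j; rewrite /mul_op /l2delta.
  by case: eqP => [->//|_]; rewrite !mulr0.
- move=> m n; rewrite /mu; case em: (f m) => [i|]; last by rewrite ltxx.
  case en: (f n) => [j|]; last by rewrite ltxx.
  move=> _ _; rewrite l2dot_deltal /l2delta; congr ((nat_of_bool _)%:R).
  apply/eqP/eqP => [ij|mn]; first by apply: (finj _ _ i); rewrite ?em ?en ?ij.
  by move: em; rewrite mn en => -[].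
- move=> xi lx orth; rewrite TE//; apply/funext => i; rewrite /mul_op.
  have [n en] := fsurj i.
  have := orth n; rewrite /mu en l2dot_deltal => -> //.
  exact: mulr0.
Qed.

(* Otherwise some nonzero vector supported on F is orthogonal to the first
   size F - 1 eigenvectors; the remaining ones vanish on F, so T kills it. *)
Lemma eigenvalue_ge (mu : nat -> R) (F : seq I) (t : R) :
  is_eigenvalue_seq T mu -> uniq F -> (0 < size F)%N ->
  (forall i, i \in F -> t <= a i) -> t <= mu (size F).-1.
Proof.
case: F => // i0 F' [_ mudecr [e [eig _ compl]]].
set F := i0 :: F'; set d := size F' => uF _ tF.
rewrite leNgt; apply/negP => mult.
pose M := \matrix_(r < d.+1, n < d) conjc (e n (nth i0 F r)).
have kerM : kermx M != 0.
  rewrite -mxrank_eq0 mxrank_ker subn_eq0 -ltnNge ltnS.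
  exact: rank_leq_col.
have /rowV0Pn[x /sub_kermxP xM x0] := kerM.
pose xi i := if i \in F then x 0 (inord (index i F)) else 0.
have xiF i : i \notin F -> xi i = 0 by rewrite /xi => /negbTE ->.
have lxi := l2_seq uF xiF.
have Txi : T xi = cst 0.
  apply: compl => // n mun0.
  rewrite (l2dot_seq uF); last by move=> i /xiF ->; rewrite mulr0.
  have [nd|dn] := ltnP n d.
    move/(congr1 (fun A : 'rV_d => A 0 (Ordinal nd))): xM.
    rewrite !mxE => xM; rewrite -[RHS]xM (big_nth i0) big_mkord.
    apply: eq_bigr => r _; rewrite !mxE /xi mem_nth//.
    by rewrite index_uniq// inord_val mulrC.
  (* For [n >= d] one has [mu n <= mu d < t], while an eigenvector lives only where [a i = mu n]. *)
  rewrite big1_seq// => i /= iF.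
  have [len en] := eig _ mun0.
  suff -> : e n i = 0 by rewrite conjc0 mul0r.
  apply/eqP; rewrite -[_ == 0]negbK; apply/negP => eni.
  move: en; rewrite TE// => /(congr1 (fun h => h i)) /(mulIf eni)/complexI ai.
  have := tF i iF; rewrite ai leNgt (le_lt_trans _ mult)//.
  exact: mudecr.
move/negP: x0; apply; apply/eqP/rowP => r; rewrite mxE.
have rF : nth i0 F r \in F by rewrite mem_nth.
move/(congr1 (fun h => h (nth i0 F r))): Txi; rewrite TE//.
rewrite /mul_op /xi rF index_uniq// inord_val /cst => /eqP.
rewrite mulf_eq0 => /orP[|/eqP//].
by rewrite eq_complex/= (gt_eqF (a0 _)).
Qed.

End eigenvalues_of_multiplication.

(** * Hausdorff premeasures of covers by balls *)

Section hausdorff.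
Context {R : realType} {X : metricType R}.
Implicit Types (q d : R) (U : set X).

Lemma hausdorff_weight_ge0 q U : (0 <= hausdorff_weight q U)%E.
Proof. by rewrite /hausdorff_weight; case: ifP => // _; exact: poweR_ge0. Qed.

Lemma hausdorff_premeasure_ge0 q d U : (0 <= hausdorff_premeasure q d U)%E.
Proof.
apply: le_ereal_inf_tmp => _ [F _ <-]; apply: nneseries_ge0 => n _ _.
exact: hausdorff_weight_ge0.
Qed.

Lemma diam_le d U : (forall x y, U x -> U y -> mdist x y <= d) ->
  (diam U <= d%:E)%E.
Proof.
move=> Ud; apply: ge_ereal_sup => _ [[x y] [/= Ux Uy] <-].
by rewrite lee_fin Ud.
Qed.

Lemma hausdorff_weight_le q d U : 0 <= q -> 0 <= d ->
  (forall x y, U x -> U y -> mdist x y <= d) ->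
  (hausdorff_weight q U <= (d `^ q)%:E)%E.
Proof.
move=> q0 d0 Ud; rewrite /hausdorff_weight; case: ifPn => [_|/set0P[x Ux]].
  by rewrite lee_fin powR_ge0.
(* Nonemptiness enters here: the supremum defining the diameter of [set0] is [-oo]. *)
have diam0 : (0 <= diam U)%E.
  by apply: ereal_sup_ubound; exists (x, x) => //=; rewrite mdistxx.
have diamd := diam_le Ud.
rewrite -poweR_EFin; apply: gt0_ler_poweR => //.
- by rewrite in_itv/= diam0 leey.
- by rewrite in_itv/= lee_fin d0 leey.
Qed.

(** The cover consists of the closed balls of radius [d] around the entries of [s], of diameter at
    most [2 * d], and continues with empty sets of weight 0. *)
Lemma hausdorff_premeasure_le (s : seq X) q d d' : 0 <= q -> 0 <= d ->
  2 * d <= d' ->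
  (forall x, exists2 y, y \in s & mdist y x <= d) ->
  (hausdorff_premeasure q d' [set: X] <= ((size s)%:R * (2 * d) `^ q)%:E)%E.
Proof.
move=> q0 d0 dd' scov.
pose F k := [set x | if onth s k is Some y then mdist y x <= d else False].
have Fd k x y : F k x -> F k y -> mdist x y <= 2 * d.
  rewrite /F/=; case: onth => // z zx zy.
  by have := metric_triangle x z y; rewrite (metric_sym x z); lra.
have d20 : 0 <= 2 * d by rewrite mulr_ge0.
apply: (@le_trans _ _ (\sum_(0 <= k <oo) hausdorff_weight q (F k))%E).
  apply: ereal_inf_lbound; exists F => //; split.
    move=> x _; have [y ys yx] := scov x; exists (index y s) => //=.
    by rewrite /F/= onthE (nth_map y) ?index_mem// nth_index.
  by move=> k; apply: le_trans (diam_le (Fd k)) _; rewrite lee_fin.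
rewrite (nneseries_split 0 (size s)); last first.
  by move=> k _; exact: hausdorff_weight_ge0.
rewrite add0n [X in (_ + X)%E]eseries0; last first.
  move=> k sk _; rewrite /hausdorff_weight (_ : F k = set0) ?eqxx//.
  by apply/seteqP; split => x //=; rewrite /F/= onth_default.
rewrite adde0 big_mkord.
have -> : (size s)%:R * (2 * d) `^ q = \sum_(k < size s) (2 * d) `^ q.
  by rewrite sumr_const card_ord mulr_natl.
rewrite -sumEFin; apply: lee_sum => k _; apply: hausdorff_weight_le => //.
exact: Fd.
Qed.

Lemma hausdorff_dim_le q : 0 <= q ->
  (forall d e, 0 < d -> 0 < e ->
     (hausdorff_premeasure q d [set: X] <= e%:E)%E) ->
  (hausdorff_dim [set: X] <= q%:E)%E.
Proof.
move=> q0 small; apply: ereal_inf_lbound; exists q => //; split => //.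
apply/eqP; rewrite eq_le; apply/andP; split.
  apply: ge_ereal_sup => _ [d d0 <-]; apply/lee_addgt0Pr => e e0.
  by rewrite add0e small.
apply: (@le_trans _ _ (hausdorff_premeasure q 1 [set: X])).
  exact: hausdorff_premeasure_ge0.
by apply: ereal_sup_ubound; exists 1 => //=.
Qed.

(** A finite upper limit bounds [covering_radius B t] by [c * t] for small [t]. This radius is an
    infimum that need not be attained, so the constant is raised to [c + 1] to obtain an actual
    radius. *)
Lemma bounding_radius_cover (B : set (X * X)) :
  (rel_bounding_radius B < +oo)%E ->
  exists2 c : R, 0 < c & \forall t \near (0 : R)^'+,
    exists d : R, [/\ 0 < d, d <= c * t &
      forall x, exists2 y, long_points B t y & mdist y x <= d].
Proof.
move=> /ereal_inf_lt[_ [V V0 <-]]; set S := ereal_sup _ => Soo.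
have [c c0 Sc] : exists2 c : R, 0 < c & (S <= c%:E)%E.
  case: S Soo => [r| |]// _; last by exists 1; rewrite ?leNye.
  exists (`|r| + 1); first by rewrite ltr_wpDl.
  by rewrite lee_fin (le_trans (ler_norm _))// lerDl.
exists (c + 1); first by rewrite addr_gt0.
near=> t.
have t0 : 0 < t by near: t; exact: nbhs_right_gt.
have Vt : V t by near: t.
have : (covering_radius B t * (t^-1)%:E <= c%:E)%E.
  by apply: le_trans Sc; apply: ereal_sup_ubound; exists t.
rewrite lee_pdivrMr// -EFinM => covc.
have : (covering_radius B t < ((c + 1) * t)%:E)%E.
  by apply: le_lt_trans covc _; rewrite lte_fin ltr_pM2r// ltrDl.
move=> /ereal_inf_lt[_ [d [d0 dcov] <-]]; rewrite lte_fin => dc.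
exists d; split => //; first exact: ltW.
by move=> x; have [y By yx] := dcov x I; exists y.
Unshelve. all: by end_near.
Qed.

End hausdorff.

(** * From logarithmic growth to power bounds *)

Section counting.
Context {R : realType}.

(** The logarithm is absorbed by the power [s = 1 - p / r] of [d]: dividing by that power bounds
    d^(p/r) t^p, and raising to the power [r / p] bounds d t^r. *)
Lemma powR_log_bound (p r C : R) : 0 < p -> p < r -> exists K : R,
  forall (d : nat) (t : R), 0 < t -> t <= 1 ->
    ((1 < d)%N -> d%:R * t `^ p <= C * ln d%:R) -> d%:R * t `^ r <= K.
Proof.
move=> p0 pr; have r0 : 0 < r := lt_trans p0 pr.
pose s := 1 - p / r.
have s0 : 0 < s by rewrite subr_gt0 ltr_pdivrMr ?mul1r.
(* The summand 1 covers [d <= 1], where the hypothesis gives nothing and t^r is at most 1. *)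
exists (1 + (`|C| / s) `^ (r / p)) => d t t0 t1 dC.
have tr1 : t `^ r <= 1.
  have := @ge0_ler_powR _ r (ltW r0) t 1; rewrite powR1 !nnegrE; apply => //.
  exact: ltW.
have K0 : 0 <= (`|C| / s) `^ (r / p) by exact: powR_ge0.
case: d dC => [|[|d]] dC; first by rewrite mul0r addr_ge0.
  by rewrite mul1r (le_trans tr1)// lerDl.
set D : R := d.+2%:R in dC *.
have D0 : 0 < D by rewrite ltr0n.
have tp0 : 0 < t `^ p by rewrite powR_gt0.
have Ds0 : 0 < D `^ s by rewrite powR_gt0.
have lnD : ln D <= D `^ s / s.
  (* This is ln x < x at x = D^s. *)
  by rewrite ler_pdivlMr// mulrC -ln_powR ltW// ln_sublinear.
have le1 : D * t `^ p <= `|C| / s * D `^ s.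
  apply: le_trans (dC isT) _; apply: (@le_trans _ _ (`|C| * ln D)).
    by rewrite ler_wpM2r ?ler_norm// ln_ge0// ler1n.
  by apply: le_trans (ler_wpM2l _ lnD) _ => //; rewrite mulrA mulrAC.
have le2 : D `^ (p / r) * t `^ p <= `|C| / s.
  rewrite -(ler_pM2r Ds0) mulrAC -powRD; last by rewrite (gt_eqF D0) implybT.
  by rewrite /s addrC subrK powRr1// ltW.
have -> : D * t `^ r = (D `^ (p / r) * t `^ p) `^ (r / p).
  have [pN0 rN0] : p != 0 /\ r != 0 by rewrite !gt_eqF.
  rewrite powRM ?powR_ge0// -!powRrM.
  rewrite (_ : p / r * (r / p) = 1); last by field; rewrite pN0.
  by rewrite powRr1 ?ltW// (_ : p * (r / p) = r)//; field.
rewrite (@le_trans _ _ ((`|C| / s) `^ (r / p)))//; last by rewrite lerDr.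
apply: ge0_ler_powR => //; rewrite ?nnegrE ?divr_ge0 ?mulr_ge0 ?powR_ge0//.
all: exact: ltW.
Qed.

Lemma log_means_bounded (mu : nat -> R) : bounded_fun (log_means mu) ->
  exists C : R, forall N, (1 < N)%N -> \sum_(n < N) mu n <= C * ln N%:R.
Proof.
move=> [C [_ HC]]; exists (C + 1) => N N1.
have lnN : 0 < ln (N%:R : R) by rewrite ln_gt0// ltr1n.
rewrite -ler_pdivrMr//; apply: le_trans (ler_norm _) _.
by apply: (HC (C + 1)) => //; rewrite ltrDl.
Qed.

End counting.

(** * Counting long pairs by means of the spectrum *)

Section dimension_bound.
Context {R : realType} {X : metricType R} (M : spectral_geometry X).

Let len (i : sg_index M) : R := pair_length (tag i).

(** The index carries an ordinal below the multiplicity, which is therefore positive. *)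
Lemma sg_index_supp (i : sg_index M) : sg_supp M (tag i).
Proof. by apply/sg_multP; case: (tagged i) => m; case: (sg_mult _ _). Qed.

Lemma sg_length_gt0 (i : sg_index M) : 0 < len i.
Proof. by rewrite mdist_gt0; apply/eqP/sg_supp_offdiag/sg_index_supp. Qed.

Lemma sg_index_finite (t : R) : 0 < t ->
  finite_set [set i : sg_index M | t <= len i].
Proof.
move=> t0; apply: (@sub_finite_set _ _
  (\bigcup_(b in long_pairs (sg_supp M) t)
     (existT (fun b => 'I_(sg_mult M b)) b @` setT))).
  move=> [b k] /= tb; exists b; last by exists k.
  by split => //; exact: (sg_index_supp (Tagged _ k)).
apply: bigcup_finite; first exact: sg_supp_finite.
by move=> b _; apply: finite_image; exact: finite_finset.
Qed.

(** Only finitely many indices have length at least 1, and the sum of their lengths dominates each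
    of them. *)
Lemma sg_length_bounded : exists C : R, forall i, len i <= C.
Proof.
pose A := fset_set [set i | 1 <= len i].
exists (1 + \sum_(i <- A) len i) => i; have [lt1|ge1] := ltP (len i) 1.
  rewrite (le_trans (ltW lt1))// lerDl sumr_ge0// => j _.
  exact/ltW/sg_length_gt0.
have iA : i \in A by rewrite in_fset_set ?mem_setE//; exact: sg_index_finite.
rewrite (bigD1_seq i) ?fset_uniq//= addrCA lerDl addr_ge0// sumr_ge0// => j _.
exact/ltW/sg_length_gt0.
Qed.

Lemma sg_index_swapK : involutive (@sg_index_swap _ _ M).
Proof.
move=> [[x y] k]; rewrite /sg_index_swap /=.
by congr (existT (fun b => 'I_(sg_mult M b)) (x, y) _); apply: val_inj.
Qed.

Lemma sg_length_swap (i : sg_index M) : len (sg_index_swap i) = len i.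
Proof. exact: metric_sym. Qed.

(** One coordinate is taken over each pair, so that distinct pairs give distinct indices; the gap
    [p < r] absorbs the logarithm coming from the trace. *)
Lemma sg_counting (w : (nat -> R) -> R) (p r : R) : 0 < p -> p < r ->
  dixmier_trace w (pow_op (abs_op (@sg_ds _ _ M)) p) <> +oo%E ->
  exists K : R, forall t (s : seq (X * X)), 0 < t -> t <= 1 -> uniq s ->
    (forall b, b \in s -> long_pairs (sg_supp M) t b) ->
    (size s)%:R * t `^ r <= K.
Proof.
move=> p0 pr; set T := pow_op _ _ => trfin.
have [C lenC] := sg_length_bounded.
have [bA AE] := abs_opE sg_length_gt0 lenC sg_index_swapK sg_length_swap.
have [bT TE] := pow_opE bA (ltW p0) sg_length_gt0 lenC AE.
have lenp0 i : 0 < len i `^ p by rewrite powR_gt0// sg_length_gt0.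
have lenp_fin (t : R) : 0 < t -> finite_set [set i | t <= len i `^ p].
  move=> t0; have tp : 0 < t `^ p^-1 by rewrite powR_gt0.
  apply: sub_finite_set (sg_index_finite tp) => i /= ti.
  have pV0 : 0 <= p^-1 by rewrite invr_ge0 ltW.
  have := @ge0_ler_powR _ _ pV0 t (len i `^ p).
  rewrite !nnegrE (ltW t0) powR_ge0 -powRrM mulfV ?gt_eqF// powRr1.
    exact.
  exact/ltW/sg_length_gt0.
have evT := eigenvaluesP lenp0 TE lenp_fin.
have [mu0 mudecr _] := evT.
have bnd : bounded_fun (log_means (eigenvalues T)).
  (* [dixmier_trace] takes the value [+oo] exactly when the logarithmic means are unbounded. *)
  by apply: contrapT => nb; apply: trfin; rewrite /dixmier_trace asboolF.
have [C' HC'] := log_means_bounded bnd.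
have [K HK] := powR_log_bound C' p0 pr.
exists K => t s t0 t1 us sB; apply: HK => // s1.
(* The first coordinate over [b], present as soon as the multiplicity is positive. *)
pose h (b : X * X) : option (sg_index M) :=
  omap (fun k : 'I_(sg_mult M b) => Tagged (fun b => 'I_(sg_mult M b)) k)
    (insub 0%N).
have hK : ocancel h tag by move=> b; rewrite /h; case: insub.
pose F := pmap h s.
have uF : uniq F by apply: (pmap_uniq hK).
have sF : size F = size s.
  rewrite size_pmap; apply/eqP; rewrite -all_count; apply/allP => b /sB[Bb _].
  by rewrite /h insubT //; apply/sg_multP.
have lenF i : i \in F -> t `^ p <= len i `^ p.
  rewrite mem_pmap => /mapP[b bs hb].
  have ib : tag i = b by have := hK b; rewrite -hb.
  apply: ge0_ler_powR; rewrite ?nnegrE.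
  - exact: ltW.
  - exact: ltW.
  - exact/ltW/sg_length_gt0.
  by rewrite /len ib; case: (sB _ bs).
apply: le_trans (HC' _ s1).
have F0 : (0 < size F)%N by rewrite sF ltnW.
have := eigenvalue_ge lenp0 TE evT uF F0 lenF; rewrite sF => mut.
(* Each of the first [size s] eigenvalues is at least the last of them, hence at least t^p. *)
rewrite mulr_natl -[X in _ *+ X]card_ord -sumr_const; apply: ler_sum => n _.
apply: le_trans mut _; apply: mudecr.
by case: n => n /=; case: (size s).
Qed.

End dimension_bound.

(** * Comparison of the two dimensions *)

Theorem corollary4p7 (R : realType) (X : metricType R)
    (w : (nat -> R) -> R) (M : spectral_geometry X) :
  compact [set: X] ->
  generalized_limit w ->
  (rel_bounding_radius (sg_supp M) < +oo)%E ->
  (hausdorff_dim [set: X] <= sg_dim M w)%E.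
Proof.
move=> _ _ nuB; rewrite leNgt; apply/negP => dimlt.
have dim0 : (0 <= sg_dim M w)%E by apply: ereal_sup_ubound; left.
(* Arguing by contradiction, p < q are inserted strictly between the two dimensions; the case split
   allows for an infinite Hausdorff dimension. *)
have [p pdim pH] : exists2 p : R, (sg_dim M w < p%:E)%E &
    (p%:E < hausdorff_dim [set: X])%E.
  move: dimlt dim0; case: (sg_dim M w) => [a| |]//=; last by rewrite ltNge leey.
  case: (hausdorff_dim _) => [b| |]//=.
    rewrite lte_fin => ab _; exists ((a + b) / 2); rewrite lte_fin; lra.
  by move=> _ _; exists (a + 1); rewrite ?ltry// lte_fin ltrDl.
have [q pq qH] : exists2 q : R, p < q & (q%:E < hausdorff_dim [set: X])%E.
  move: pH; case: (hausdorff_dim _) => [b| |]//=.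
    rewrite lte_fin => pb; exists ((p + b) / 2); rewrite ?lte_fin; lra.
  by move=> _; exists (p + 1); rewrite ?ltry// ltrDl.
have p0 : 0 < p by rewrite -lte_fin (le_lt_trans dim0).
have trfin : dixmier_trace w (pow_op (abs_op (@sg_ds _ _ M)) p) <> +oo%E.
  move=> troo; move: pdim; apply/negP; rewrite -leNgt.
  by apply: ereal_sup_ubound; right; exists p => //; split => //; exact: ltW.
move: qH; apply/negP; rewrite -leNgt.
(* Room on both sides: [p < r] serves the counting bound, and [r < q] makes t^(q - r) tend to 0. *)
pose r := (p + q) / 2.
have [pr rq] : p < r /\ r < q by rewrite /r; split; lra.
have q0 : 0 < q by exact: lt_trans pq.
have [K HK] := sg_counting p0 pr trfin.
have [c c0 cov] := bounding_radius_cover nuB.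
apply: (hausdorff_dim_le (ltW q0)) => d e d0 e0.
have qr0 : 0 < q - r by rewrite subr_gt0.
(* [c'] bounds the factor of t^(q - r) in the final estimate, with [+ 1] to make it positive; [t1]
   then solves c' t^(q - r) = e. *)
pose c' := `|K| * (2 * c) `^ q + 1.
have c'0 : 0 < c' by rewrite ltr_wpDl// mulr_ge0// powR_ge0.
pose t1 := (e / c') `^ (q - r)^-1.
have t10 : 0 < t1 by rewrite powR_gt0// divr_gt0.
near (0 : R)^'+ => t.
have t0 : 0 < t by near: t; exact: nbhs_right_gt.
have tle1 : t <= 1 by near: t; exact: nbhs_right_ltW.
have tt1 : t <= t1 by near: t; exact: nbhs_right_ltW.
have td : t <= d / (2 * c).
  by near: t; apply: nbhs_right_ltW; rewrite divr_gt0// mulr_gt0.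
have [d1 [d10 d1c d1cov]] : exists d : R, [/\ 0 < d, d <= c * t &
      forall x, exists2 y, long_points (sg_supp M) t y & mdist y x <= d].
  by near: t.
have Bfin := @sg_supp_finite _ _ M t t0.
pose s : seq (X * X) := fset_set (long_pairs (sg_supp M) t).
have sE b : (b \in s) = (b \in long_pairs (sg_supp M) t) by rewrite in_fset_set.
have sK : (size s)%:R * t `^ r <= K.
  by apply: HK => //; [exact: fset_uniq|move=> b; rewrite sE => /set_mem].
have td' : 2 * (c * t) <= d by rewrite mulrA -ler_pdivlMl 1?mulrC// mulr_gt0.
have ct0 : 0 <= c * t by rewrite mulr_ge0 ?ltW.
(* The radius [d1] is enlarged to its bound [c * t]; the centres are the first components of the
   long pairs, possibly repeated. *)
apply: le_trans
  (@hausdorff_premeasure_le _ _ (map fst s) _ _ _ (ltW q0) ct0 td' _) _.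
  move=> x; have [_ [b Bb <-] bx] := d1cov x.
  exists b.1; last exact: le_trans d1c.
  by apply: map_f; rewrite sE; exact: mem_set.
rewrite lee_fin size_map.
(* Splitting off t^r lets [sK] absorb the number of balls. *)
have -> : (2 * (c * t)) `^ q = (2 * c) `^ q * (t `^ r * t `^ (q - r)).
  rewrite mulrA powRM ?mulr_ge0 ?ltW// -powRD; last first.
    by rewrite (gt_eqF t0) implybT.
  by rewrite addrC subrK.
have tqr : t `^ (q - r) <= e / c'.
  have := @ge0_ler_powR _ (q - r) (ltW qr0) t t1.
  rewrite !nnegrE (ltW t0) (ltW t10) => /(_ isT isT tt1).
  rewrite /t1 -powRrM mulVf ?gt_eqF// powRr1//.
  by rewrite ltW// divr_gt0.
apply: (@le_trans _ _ (c' * (e / c'))); last first.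
  by rewrite mulrCA mulfV ?gt_eqF// mulr1.
have -> : (size s)%:R * ((2 * c) `^ q * (t `^ r * t `^ (q - r))) =
   ((size s)%:R * t `^ r * (2 * c) `^ q) * t `^ (q - r) by ring.
apply: ler_pM => //; rewrite ?mulr_ge0 ?powR_ge0//.
rewrite (@le_trans _ _ (`|K| * (2 * c) `^ q))//; last by rewrite lerDl.
by rewrite ler_wpM2r ?powR_ge0// (le_trans sK)// ler_norm.
Unshelve. all: by end_near.
Qed.
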